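(* For any graph $A$ it holds that $A \triangleright F(1,1)$ if and only if $A \leadsto F(1,1)$.
   Context: A graph has finite vertex and edge sets; every edge is either a normal edge (incident with two distinct vertices, adding 1 to the degree of each), a loop (incident with one vertex, adding 2 to its degree) or a semi-edge (incident with one vertex, adding 1 to its degree). Multiple loops, semi-edges and parallel normal edges are allowed. A graph is simple if it has no loops, no semi-edges and no parallel normal edges. A covering projection from a graph $G$ to a connected graph $H$ is a pair of surjective maps $f_V:V(G)\to V(H)$, $f_E:E(G)\to E(H)$ such that $f_V$ preserves degrees; $f_E$ maps semi-edges onto semi-edges and loops onto loops (normal edges may be mapped onto normal edges, loops or semi-edges); $f_E$ preserves incidence; and $f_E$ is a local bijection between the edge-neighborhood of every vertex and that of its image (so the preimage of a loop at $u$ is a disjoint union of cycles spanning $f_V^{-1}(u)$, the preimage of a semi-edge at $u$ is a disjoint union of semi-edges and normal edges covering each vertex of $f_V^{-1}(u)$ exactly once, and the preimage of a normal edge $uv$ is a perfect matching between $f_V^{-1}(u)$ and $f_V^{-1}(v)$). $G\longrightarrow H$ means such a projection exists. A semi-covering projection is defined the same way, except that semi-edges may be mapped onto semi-edges or onto loops (loops still map only onto loops, and normal edges onto normal edges, loops or semi-edges); thus the preimage of a loop at $u$ is a disjoint union of cycles and of paths carrying a semi-edge at each end-vertex, spanning $f_V^{-1}(u)$. $G\leadsto H$ means a semi-covering projection from $G$ to $H$ exists. $A \triangleright B$ means every simple graph covering $A$ also covers $B$. $F(a,b)$ is the one-vertex graph with $a$ semi-edges and $b$ loops. *)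

(* Defs.v *)
From mathcomp Require Import all_boot.

Set Implicit Arguments.
Unset Strict Implicit.
Unset Printing Implicit Defensive.

Inductive edge_kind := Normal | Loop | Semi.

Record graph := Graph {
  vertex : finType;
  edge : finType;
  kind : edge -> edge_kind;
  ends : edge -> {set vertex};
  card_ends : forall e, #|ends e| = if kind e is Normal then 2 else 1
}.

Definition is_loop (G : graph) (e : edge G) : bool :=
  if kind e is Loop then true else false.

Definition deg (G : graph) (x : vertex G) : nat :=
  \sum_(e | x \in ends e) (if is_loop e then 2 else 1).

Definition simple (G : graph) : Prop :=
  (forall e : edge G, kind e = Normal) /\
  (forall e1 e2 : edge G, ends e1 = ends e2 -> e1 = e2).

(* The edge-neighborhood of x is the set of edge-ends at x.  A loop has two
   ends, (e, false) and (e, true); any other edge has the single end (e, false)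
   at each vertex it is incident with.  So #|edge_nbhd x| = deg x. *)
Definition edge_nbhd (G : graph) (x : vertex G) : {set edge G * bool} :=
  [set h | (x \in ends h.1) && (h.2 ==> is_loop h.1)].

Definition surjective (S T : Type) (f : S -> T) : Prop :=
  forall y, exists x, f x = y.

(* fE induces a bijection from the edge-ends at x onto the edge-ends at fV x.
   Counting ends rather than edges is what lets two normal edges at x lie over
   one loop at fV x. *)
Definition local_bijection (G H : graph) (fV : vertex G -> vertex H)
    (fE : edge G -> edge H) (x : vertex G) : Prop :=
  exists g : edge G * bool -> edge H * bool,
    [/\ {in edge_nbhd x, forall h, (g h).1 = fE h.1},
        {in edge_nbhd x &, injective g}
      & g @: edge_nbhd x = edge_nbhd (fV x)].

(* The first kind is that of an edge, the second that of its image. *)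
Definition cover_kind (k k' : edge_kind) : Prop :=
  match k with
  | Normal => True
  | Loop => k' = Loop
  | Semi => k' = Semi
  end.

Definition semicover_kind (k k' : edge_kind) : Prop :=
  match k with
  | Normal => True
  | Loop => k' = Loop
  | Semi => k' = Semi \/ k' = Loop
  end.

(* Incidence is preserved end by end: the ends of e are mapped onto those of
   fE e, so both ends of a normal edge cannot be sent to the same end of a
   normal edge. *)
Record projection (allowed : edge_kind -> edge_kind -> Prop) (G H : graph)
    (fV : vertex G -> vertex H) (fE : edge G -> edge H) : Prop := {
  proj_surjV : surjective fV;
  proj_surjE : surjective fE;
  proj_deg : forall x, deg (fV x) = deg x;
  proj_kind : forall e, allowed (kind e) (kind (fE e));
  proj_ends : forall e, fV @: ends e = ends (fE e);
  proj_local : forall x, local_bijection fV fE x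
}.

Definition covers (G H : graph) : Prop :=
  exists fV fE, @projection cover_kind G H fV fE.

Definition semicovers (G H : graph) : Prop :=
  exists fV fE, @projection semicover_kind G H fV fE.

Definition stronger (A B : graph) : Prop :=
  forall G : graph, simple G -> covers G A -> covers G B.

Definition F_kind (a b : nat) (e : 'I_a + 'I_b) : edge_kind :=
  if e is inl _ then Semi else Loop.

Lemma F_card_ends (a b : nat) (e : 'I_a + 'I_b) :
  #|[set tt]| = if F_kind e is Normal then 2 else 1.
Proof. by rewrite cards1; case: e. Qed.

Definition F (a b : nat) : graph := Graph (@F_card_ends a b).

(* Main.v *)
(** Projections compose, and for a simple graph covering and semi-covering
    coincide; this gives one direction.  For the other, a semi-covering of
    F(1,1) by a cubic graph is a perfect matching in which a semi-edge may match
    its vertex alone.  It suffices to build a simple cover G of A every perfect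
    matching of which induces one on A.  Let B be a simple cover of A with an
    even number of vertices, obtained from voltages in (Z/4)^E.  Take two copies
    of A; replace each edge uv of a copy by a copy of B with one edge xy over uv
    removed, joining u to y and v to x.  As B is even, a perfect matching uses
    both joining edges or neither, so it restricts to a matching of A; for a
    loop it uses neither, as both joining edges meet u.  For a semi-edge at u
    only y is joined to u, and the vertices x of the two copies are joined to
    each other. *)

Require Import Defs.
From mathcomp Require Import all_boot ssralg zmodp.

Set Implicit Arguments.
Unset Strict Implicit.
Unset Printing Implicit Defensive.

(** * Degrees and composition of projections *)

Lemma ends_ex (G : graph) (e : edge G) : exists x, x \in ends e.
Proof. by apply/set0Pn; rewrite -card_gt0 card_ends; case: kind. Qed.

Lemma deg_card_nbhd (G : graph) (x : vertex G) : deg x = #|edge_nbhd x|.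
Proof.
rewrite -sum1_card /edge_nbhd; under [RHS]eq_bigl do rewrite inE.
rewrite -(pair_big_dep (fun e : edge G => x \in ends e)
  (fun e b => b ==> is_loop e) (fun _ _ => 1)) /=.
by apply: eq_bigr => e _; rewrite big_mkcond big_bool /=; case: is_loop.
Qed.

Lemma local_bijection_deg (G H : graph) (fV : vertex G -> vertex H)
    (fE : edge G -> edge H) (x : vertex G) :
  local_bijection fV fE x -> deg (fV x) = deg x.
Proof. by case=> g [_ g_inj g_im]; rewrite !deg_card_nbhd -g_im card_in_imset. Qed.

Lemma projection_comp (k1 k2 k3 : edge_kind -> edge_kind -> Prop)
    (G H K : graph) fV fE hV hE :
  (forall a b c, k1 a b -> k2 b c -> k3 a c) ->
  @projection k1 G H fV fE -> @projection k2 H K hV hE ->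
  projection k3 (hV \o fV) (hE \o fE).
Proof.
move=> k123 [sV sE dg kd en lc] [sV' sE' dg' kd' en' lc'].
have local_comp x : local_bijection (hV \o fV) (hE \o fE) x.
  have [g [g1 g_inj g_im]] := lc x; have [g' [g1' g_inj' g_im']] := lc' (fV x).
  have gN h : h \in edge_nbhd x -> g h \in edge_nbhd (fV x).
    by move=> Nh; rewrite -g_im imset_f.
  exists (g' \o g); split=> [h Nh | h1 h2 N1 N2 /= /g_inj' g12 |].
  - by rewrite /= g1' ?g1 ?gN.
  - by apply: g_inj => //; apply: g12; apply: gN.
  - by rewrite imset_comp g_im g_im'.
split=> //.
- by move=> z; have [y <-] := sV' z; have [x <-] := sV y; exists x.
- by move=> z; have [y <-] := sE' z; have [x <-] := sE y; exists x.
- by move=> x; apply: local_bijection_deg.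
- by move=> e; apply: k123 (kd e) (kd' _).
- by move=> e; rewrite imset_comp en en'.
Qed.

Lemma semicovers_stronger (A B : graph) : semicovers A B -> stronger A B.
Proof.
move=> [hV [hE pAB]] G [G_normal _] [fV [fE pGA]].
exists (hV \o fV), (hE \o fE).
(* The composite carries no condition on kinds: every edge of [G] is normal, and [cover_kind] allows
   any image for such an edge. *)
have [sV sE dg _ en lc] := projection_comp
  (k3 := fun _ _ => True) (fun _ _ _ _ _ => I) pGA pAB.
by split=> // e; rewrite G_normal.
Qed.

(** * Matchings and F(1,1) *)

Lemma nbhd_F11 : edge_nbhd (tt : vertex (F 1 1)) =
  [set (inl ord0, false); (inr ord0, false); (inr ord0, true)].
Proof.
apply/setP => -[e b]; rewrite !inE; case: e => i; rewrite (ord1 i);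
by case: b; rewrite !xpair_eqE ?eqxx ?andbF ?orbT.
Qed.

Lemma deg_F11 (x : vertex (F 1 1)) : deg x = 3.
Proof.
case: x; rewrite deg_card_nbhd nbhd_F11.
by rewrite setUC cardsU1 !inE cards2 !xpair_eqE.
Qed.

(** Counting ends rather than edges keeps loops out of [M], as a loop has two ends at its vertex,
    while a semi-edge in [M] matches its vertex alone. *)
Definition perfect_matching (G : graph) (M : {set edge G}) : Prop :=
  forall x : vertex G, exists2 h, h \in edge_nbhd x &
    {in edge_nbhd x, forall k, (k.1 \in M) = (k == h)}.

(** The semi-edge of [F 1 1] has a single end, and the local bijection at [x] puts exactly one end
    over it. *)
Lemma projection_F11_matching (k : edge_kind -> edge_kind -> Prop) (G : graph)
    fV fE :
  @projection k G (F 1 1) fV fE -> perfect_matching [set e | fE e == inl ord0].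
Proof.
case=> _ _ _ _ _ lc x; have [g [g1 g_inj g_im]] := lc x.
have Nx : (inl ord0, false) \in edge_nbhd (fV x).
  by case: (fV x); rewrite nbhd_F11 !inE eqxx.
have := Nx; rewrite -g_im => /imsetP[h Nh gh]; exists h => // h' Nh'.
rewrite inE -g1 //; apply/eqP/eqP => [gh'|->]; last by rewrite -gh.
apply: g_inj => //; rewrite -gh.
have := imset_f g Nh'; rewrite g_im; case: (fV x); rewrite nbhd_F11 !inE.
by case: (g h') gh' => _ b /= -> /orP[/orP[]|] /eqP.
Qed.

(** Edges of [M] go to the semi-edge, all others to the loop. Two ends per vertex remain outside
    [M], one for each end of the loop. A semi-edge outside [M] lies over the loop, which only a
    semi-covering permits. *)
Lemma matching_semicovers_F11 (A : graph) (x0 : vertex A) (M : {set edge A}) :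
  (forall x : vertex A, deg x = 3) -> perfect_matching M ->
  semicovers A (F 1 1).
Proof.
move=> deg3 pM.
pose fV (_ : vertex A) : vertex (F 1 1) := tt.
pose fE (e : edge A) : edge (F 1 1) := if e \in M then inl ord0 else inr ord0.
have lc x : local_bijection fV fE x.
  have [a Na Ma] := pM x.
  have : #|edge_nbhd x :\ a| == 2.
    by rewrite -eqSS -[_.+1]/(true + _) -Na -cardsD1 -deg_card_nbhd deg3.
  case/cards2P => b [c [neq_bc Nbc]].
  have nbhdE h : (h \in edge_nbhd x) = [|| h == a, h == b | h == c].
    have /setP/(_ h) := Nbc; rewrite in_setD1 in_set2 => <-.
    by have [->|] := eqVneq h a; rewrite ?Na.
  have /setP/(_ b) := Nbc; rewrite in_setD1 !inE eqxx => /andP[ba _].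
  have /setP/(_ c) := Nbc; rewrite in_setD1 !inE eqxx orbT => /andP[ca _].
  (* Which of [b] and [c] gets the second end of the loop is chosen separately at each vertex, so
     the cycles and paths outside [M] need not be oriented. *)
  pose g (h : edge A * bool) : edge (F 1 1) * bool := (fE h.1, h == c).
  have ga : g a = (inl ord0, false).
    by rewrite /g /fE Ma // eqxx eq_sym (negPf ca).
  have gb : g b = (inr ord0, false).
    by rewrite /g /fE Ma ?nbhdE ?eqxx ?orbT // (negPf ba) (negPf neq_bc).
  have gc : g c = (inr ord0, true).
    by rewrite /g /fE Ma ?nbhdE ?eqxx ?orbT // (negPf ca).
  exists g; split=> //.
    by move=> h1 h2; rewrite !nbhdE => /or3P[]/eqP-> /or3P[]/eqP->;
       rewrite ?ga ?gb ?gc.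
  have -> : edge_nbhd x = [set a; b; c].
    by apply/setP=> h; rewrite nbhdE !inE orbA.
  by rewrite !imsetU !imset_set1 ga gb gc -nbhd_F11.
exists fV, fE; split=> //.
- by case; exists x0.
- move=> e; have [g [g1 _ g_im]] := lc x0.
  have : (e, false) \in edge_nbhd (fV x0).
    by rewrite nbhd_F11 !inE; case: e => i; rewrite (ord1 i) eqxx ?orbT.
  by rewrite -g_im => /imsetP[h Nh gh]; exists h.1; rewrite -g1 // -gh.
- by move=> x; apply: local_bijection_deg.
- move=> e; rewrite /fE; case ke: (kind e) => //=; last by case: ifP; [left|right].
  case: ifP => // eM.
  (* A loop in [M] would have both its ends equal to the single matched end at [x]. *)
  have [x xe] := ends_ex e; have [h Nh Mh] := pM x.
  have Nxe b : (e, b) \in edge_nbhd x by rewrite inE /= xe /is_loop ke implybT.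
  have := Mh _ (Nxe true); have := Mh _ (Nxe false).
  by rewrite /= eM => /esym/eqP <- /esym/eqP.
- move=> e; apply/setP=> -[]; rewrite [RHS](_ : _ = true); last first.
    by rewrite /fE; case: ifP => _; rewrite inE.
  by have [x xe] := ends_ex e; apply/imsetP; exists x.
Qed.

(** * Edge-ends and lifts *)

(** The default [u] serves loops and semi-edges, which have no other end-vertex. *)
Definition opposite (A : graph) (u : vertex A) (e : edge A) : vertex A :=
  odflt u [pick w in ends e :\ u].

(** The same edge seen from its other end: the ends of a loop are exchanged, a semi-edge is its own
    reverse, and a normal edge has the same pair at both vertices. *)
Definition reverse (A : graph) (h : edge A * bool) : edge A * bool :=
  (h.1, is_loop h.1 && ~~ h.2).

Lemma ends_opposite (A : graph) (u : vertex A) (e : edge A) :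
  u \in ends e -> ends e = [set u; opposite u e].
Proof.
move=> ue; have := cardsD1 u (ends e).
rewrite card_ends ue /opposite; case: pickP => [w | none]; last first.
  move=> _; rewrite /= setUid; apply/setP=> w; rewrite inE.
  by have := none w; rewrite !inE; case: eqP => //= ->.
rewrite !inE => /andP[wu we]; case: kind => -[card_eq]; last 2 first.
- by have := cards0_eq (esym card_eq) => /setP/(_ w); rewrite !inE wu we.
- by have := cards0_eq (esym card_eq) => /setP/(_ w); rewrite !inE wu we.
have /esym/eqP/cards1P[z /setP Dz] := card_eq.
have := Dz w; rewrite !inE wu we => /esym/eqP Dw; apply/setP=> x.
have := Dz x; rewrite !inE -Dw /=; have [-> _|_ /= -> //] := eqVneq x u.
by rewrite ue.
Qed.

Lemma opposite_in (A : graph) (u : vertex A) (e : edge A) :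
  u \in ends e -> opposite u e \in ends e.
Proof. by move=> /ends_opposite ->; rewrite !inE eqxx orbT. Qed.

Lemma opposite_normal (A : graph) (u : vertex A) (e : edge A) :
  u \in ends e -> (opposite u e != u) = (if kind e is Normal then true else false).
Proof.
move=> /ends_opposite ende; have := card_ends e.
by rewrite ende cards2 eq_sym; case: kind; case: (_ == u).
Qed.

Lemma opposite_loop (A : graph) (u : vertex A) (e : edge A) :
  u \in ends e -> is_loop e -> opposite u e = u.
Proof.
move=> ue; rewrite /is_loop; have := opposite_normal ue.
by case: kind => // /negbFE/eqP.
Qed.

Lemma opposite_unique (A : graph) (u v : vertex A) (e : edge A) :
  u \in ends e -> v \in ends e -> v != u -> v = opposite u e.
Proof.
move=> /ends_opposite ->; rewrite !inE => /orP[/eqP-> | /eqP->//].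
by rewrite eqxx.
Qed.

Lemma oppositeK (A : graph) (u : vertex A) (e : edge A) :
  u \in ends e -> opposite (opposite u e) e = u.
Proof.
move=> ue; have oe := opposite_in ue.
have [ou|ou] := eqVneq (opposite u e) u; first by rewrite !ou.
by rewrite -(opposite_unique oe ue) // eq_sym.
Qed.

Lemma nbhd_end (A : graph) (u : vertex A) (h : edge A * bool) :
  h \in edge_nbhd u -> u \in ends h.1.
Proof. by rewrite inE => /andP[]. Qed.

Lemma nbhd_false (A : graph) (u : vertex A) (e : edge A) :
  u \in ends e -> (e, false) \in edge_nbhd u.
Proof. by rewrite inE => ->. Qed.

Lemma reverse_nbhd (A : graph) (u : vertex A) (h : edge A * bool) :
  h \in edge_nbhd u -> reverse h \in edge_nbhd (opposite u h.1).
Proof.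
rewrite !inE /reverse /= => /andP[/opposite_in -> _] /=.
by case: is_loop; rewrite ?implybT.
Qed.

Lemma reverseK (A : graph) (u : vertex A) (h : edge A * bool) :
  h \in edge_nbhd u -> reverse (reverse h) = h.
Proof.
by case: h => e b; rewrite inE /reverse /= => /andP[_]; case: is_loop; case: b.
Qed.

(* A covering graph presented by its permutation of edge-ends: [nb v h] is the
   vertex reached from [v] along the end [h] at [proj v].  Only ends [h] in
   [edge_nbhd (proj v)] matter; other values of [nb] are junk. *)
Record lift (A : graph) := Lift {
  lvertex : finType;
  proj : lvertex -> vertex A;
  nb : lvertex -> edge A * bool -> lvertex;
  proj_ex : forall u, exists v, proj v == u;
  proj_nb : forall v h, h \in edge_nbhd (proj v) ->
    proj (nb v h) = opposite (proj v) h.1;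
  nb_reverse : forall v h, h \in edge_nbhd (proj v) -> nb (nb v h) (reverse h) = v;
  nb_inj : forall v, {in edge_nbhd (proj v) &, injective (nb v)}
}.

(** * The simple graph of a loopless lift *)

Definition loopless (A : graph) (L : lift A) : Prop :=
  forall (v : lvertex L) h, h \in edge_nbhd (proj v) -> nb v h != v.

Lemma reverse_nbhd_nb (A : graph) (L : lift A) (v : lvertex L) h :
  h \in edge_nbhd (proj v) -> reverse h \in edge_nbhd (proj (nb v h)).
Proof. by move=> Nh; rewrite proj_nb ?reverse_nbhd. Qed.

(** An edge can be encoded by its vertex set because [nb_inj] gives distinct ends at a vertex
    distinct neighbours. *)
Definition is_ledge (A : graph) (L : lift A) (s : {set lvertex L}) : bool :=
  [exists d : lvertex L * (edge A * bool),
    (d.2 \in edge_nbhd (proj d.1)) && (s == [set d.1; nb d.1 d.2])].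

Definition ledge (A : graph) (L : lift A) := {s : {set lvertex L} | is_ledge s}.

Lemma ledge_ex (A : graph) (L : lift A) (s : ledge L) :
  exists d : lvertex L * (edge A * bool),
    (d.2 \in edge_nbhd (proj d.1)) && (val s == [set d.1; nb d.1 d.2]).
Proof. exact/existsP/(valP s). Qed.

Definition ledge_proj (A : graph) (L : lift A) (s : ledge L) : edge A :=
  (xchoose (ledge_ex s)).2.1.

Lemma card_ledge (A : graph) (L : lift A) (simL : loopless L) (s : ledge L) :
  #|val s| = 2.
Proof.
have [[v h] /andP[/= Nh /eqP->]] := ledge_ex s.
by rewrite cards2 eq_sym simL.
Qed.

Definition lift_graph (A : graph) (L : lift A) (simL : loopless L) : graph :=
  @Graph (lvertex L) (ledge L) (fun _ => Normal) (fun s => val s)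
    (card_ledge simL).

Lemma lift_graph_simple (A : graph) (L : lift A) (simL : loopless L) :
  simple (lift_graph simL).
Proof. by split=> // s t; apply: val_inj. Qed.

Lemma ledge_mk (A : graph) (L : lift A) (v : lvertex L) h :
  h \in edge_nbhd (proj v) -> {s : ledge L | val s = [set v; nb v h]}.
Proof.
move=> Nh; have Ps : is_ledge [set v; nb v h].
  by apply/existsP; exists (v, h); rewrite Nh /=.
by exists (exist (@is_ledge A L) _ Ps).
Qed.

(** At a common starting vertex [nb_inj] identifies the ends. Otherwise [w] is the far vertex, where
    [k] and [reverse h] both lead back to [v]. *)
Lemma pair_set_nb (A : graph) (L : lift A) (v w : lvertex L) h k :
  h \in edge_nbhd (proj v) -> k \in edge_nbhd (proj w) ->
  nb v h != v -> [set v; nb v h] = [set w; nb w k] ->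
  v = w /\ h = k \/ w = nb v h /\ k = reverse h.
Proof.
move=> Nh Nk nvh eq_s.
have [eq_vw|nvw] := eqVneq v w.
  left; split=> //; subst w; apply: (nb_inj Nh Nk).
  have /setP/(_ (nb v h)) := eq_s.
  by rewrite !inE eqxx orbT (negPf nvh) => /esym/eqP.
have eq_w : w = nb v h.
  have /setP/(_ w) := eq_s; rewrite !inE eqxx eq_sym (negPf nvw).
  by move/eqP.
right; split=> //; subst w; apply: (nb_inj Nk (reverse_nbhd_nb Nh)).
rewrite nb_reverse //; have /setP/(_ v) := eq_s.
by rewrite !inE eqxx eq_sym (negPf nvh) => /esym/eqP.
Qed.

(** The choice made in [ledge_proj] is harmless: the possible ends are reverses of each other and
    belong to the same edge of [A]. *)
Lemma ledge_projE (A : graph) (L : lift A) (s : ledge L) v h :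
  loopless L -> h \in edge_nbhd (proj v) -> val s = [set v; nb v h] ->
  ledge_proj s = h.1.
Proof.
move=> simL Nh sE; rewrite /ledge_proj.
case: (xchoose _) (xchooseP (ledge_ex s)) => w k /= /andP[Nk /eqP].
by rewrite sE => /(pair_set_nb Nh Nk (simL _ _ Nh)) [[_ ->]|[_ ->]].
Qed.

Lemma ledge_at (A : graph) (L : lift A) (s : ledge L) v :
  v \in val s -> exists2 h, h \in edge_nbhd (proj v) & val s = [set v; nb v h].
Proof.
have [[w k] /andP[/= Nk /eqP->]] := ledge_ex s.
rewrite !inE => /orP[]/eqP->; first by exists k.
by exists (reverse k); rewrite ?reverse_nbhd_nb // nb_reverse // setUC.
Qed.

Lemma lift_graph_projection (A : graph) (L : lift A) (simL : loopless L) :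
  @projection cover_kind (lift_graph simL) A (@proj A L) (@ledge_proj A L).
Proof.
have lc v : @local_bijection (lift_graph simL) A (@proj A L) (@ledge_proj A L) v.
  pose at_v (s : ledge L) h :=
    (h \in edge_nbhd (proj v)) && (val s == [set v; nb v h]).
  (* [g] inverts the map from [h] to [[set v; nb v h]]; the default occurs only for edges away from
     [v]. *)
  pose g (d : ledge L * bool) : edge A * bool :=
    odflt (ledge_proj d.1, false) [pick h | at_v d.1 h].
  have gP d : d \in @edge_nbhd (lift_graph simL) v -> at_v d.1 (g d).
    rewrite inE /= => /andP[/ledge_at[h Nh sE] _].
    rewrite /g; case: pickP => // /(_ h); by rewrite /at_v Nh sE eqxx.
  have at_false d : d \in @edge_nbhd (lift_graph simL) v -> d.2 = false.
    by rewrite inE => /andP[_]; case: d.2.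
  exists g; split.
  - move=> d /gP/andP[Ng /eqP sE].
    by rewrite [RHS](ledge_projE simL Ng sE).
  - move=> [s b] [t c] Ns Nt gst.
    have /andP[_ /eqP/= sE] := gP _ Ns; have /andP[_ /eqP/= tE] := gP _ Nt.
    have /= -> := at_false _ Ns; have /= -> := at_false _ Nt.
    by congr (_, _); apply: val_inj; rewrite /= sE tE gst.
  - apply/setP=> h; apply/imsetP/idP => [[d /gP/andP[Ng _] ->] // | Nh].
    have [s sE] := ledge_mk Nh.
    have Ns : (s, false) \in @edge_nbhd (lift_graph simL) v.
      by rewrite inE /= sE !inE eqxx.
    exists (s, false) => //; have /andP[Ng /eqP/=] := gP _ Ns.
    by rewrite sE => /(pair_set_nb Nh Ng (simL _ _ Nh)) [[_ //]|[/eqP]];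
       rewrite eq_sym (negPf (simL _ _ Nh)).
split=> //.
- by move=> u; have [v /eqP] := proj_ex L u; exists v.
- move=> e; have [u ue] := ends_ex e; have [v /eqP pv] := proj_ex L u.
  have Nv : (e, false) \in edge_nbhd (proj v) by rewrite pv nbhd_false.
  by have [s sE] := ledge_mk Nv; exists s; rewrite (ledge_projE simL Nv sE).
- by move=> v; apply: local_bijection_deg.
- move=> s; have [[v h] /andP[/= Nh /eqP sE]] := ledge_ex s.
  rewrite (ledge_projE simL Nh sE) /= sE imsetU1 imset_set1 proj_nb //.
  by rewrite -ends_opposite // nbhd_end.
Qed.

(** * Loopless lifts under the hypothesis [stronger A (F 1 1)] *)

Lemma stronger_lift_covers (A : graph) (L : lift A) (simL : loopless L) B :
  stronger A B -> covers (lift_graph simL) B.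
Proof.
apply; first exact: lift_graph_simple.
by do 2![eexists]; apply: lift_graph_projection.
Qed.

Lemma stronger_F11_deg (A : graph) (L : lift A) :
  loopless L -> stronger A (F 1 1) -> forall u : vertex A, deg u = 3.
Proof.
move=> simL /(stronger_lift_covers simL)[fV [fE pF]] u.
have [v /eqP <-] := proj_ex L u.
by rewrite (proj_deg (lift_graph_projection simL)) -(proj_deg pF) deg_F11.
Qed.

Lemma stronger_F11_vertex (A : graph) (L : lift A) :
  loopless L -> stronger A (F 1 1) -> exists u : vertex A, true.
Proof.
move=> simL /(stronger_lift_covers simL)[fV [fE pF]].
by have [v _] := proj_surjV pF tt; exists (proj (v : lvertex L)).
Qed.

(** In terms of ends the matching becomes a function on vertices, and [nb_reverse] makes the map
    from [v] to [nb v (m v)] an involution. *)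
Lemma stronger_F11_matching (A : graph) (L : lift A) :
  loopless L -> stronger A (F 1 1) ->
  exists2 m : lvertex L -> edge A * bool,
    forall v, m v \in edge_nbhd (proj v) &
    forall v, m (nb v (m v)) = reverse (m v).
Proof.
move=> simL /(stronger_lift_covers simL)[fV [fE pF]].
have pM := projection_F11_matching pF; set M := [set e | _] in pM.
pose inM v h := (h \in edge_nbhd (proj v)) &&
  [exists s : ledge L, (val s == [set v; nb v h]) && (s \in M)].
have inM_ex v : exists h, inM v h.
  have [[s b] Ns] := pM v; have := Ns; rewrite inE => /andP[/ledge_at[h Nh sE] _].
  move/(_ _ Ns); rewrite eqxx => sM.
  by exists h; rewrite /inM Nh; apply/existsP; exists s; rewrite sE eqxx.
have inM_unique v h k : inM v h -> inM v k -> h = k.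
  case/andP=> Nh /existsP[s /andP[/eqP sE sM]].
  case/andP=> Nk /existsP[t /andP[/eqP tE tM]].
  have [d _ dM] := pM v.
  have Nv r l : val r = [set v; nb v l] ->
    (r, false) \in @edge_nbhd (lift_graph simL) v.
    by move=> rE; rewrite inE /= rE !inE eqxx.
  have := dM _ (Nv _ _ sE); have := dM _ (Nv _ _ tE).
  rewrite /= sM tM => /esym/eqP td /esym/eqP; rewrite -td => -[st].
  have := sE; rewrite st tE => /esym /(pair_set_nb Nh Nk (simL _ _ Nh)).
  by case=> [[]//|[/eqP]]; rewrite eq_sym (negPf (simL _ _ Nh)).
pose m v := xchoose (inM_ex v).
have mP v : inM v (m v) := xchooseP (inM_ex v).
exists m => v; first by case/andP: (mP v).
have /andP[Nm /existsP[s /andP[/eqP sE sM]]] := mP v.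
apply: inM_unique (mP _) _; rewrite /inM reverse_nbhd_nb //=.
by apply/existsP; exists s; rewrite sM nb_reverse // sE setUC eqxx.
Qed.

(** * Three lifts *)

(** Reversal must negate the voltage, so a normal edge or semi-edge needs a self-opposite value and
    the two ends of a loop need opposite ones. In Z/4 the values 2, 1 and -1 do this, all nonzero
    and distinct. One coordinate per edge separates the ends of different edges. *)
Definition voltage (A : graph) (h : edge A * bool) : {ffun edge A -> 'Z_4} :=
  [ffun e => if e == h.1 then
               if is_loop e then if h.2 then -1 else 1 else 2%:R
             else 0]%R.

Lemma voltage_reverse (A : graph) (h : edge A * bool) :
  h.2 ==> is_loop h.1 -> voltage (reverse h) = (- voltage h)%R.
Proof.
move=> hl; apply/ffunP=> e; rewrite !ffunE /reverse /=.
have [->|_] := eqVneq e h.1; last by rewrite GRing.oppr0.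
by case: is_loop hl; case: h.2 => //= _; apply/val_inj.
Qed.

Lemma voltage_neq0 (A : graph) (h : edge A * bool) : voltage h != 0%R.
Proof.
apply/eqP=> /ffunP/(_ h.1); rewrite !ffunE eqxx.
by case: is_loop; case: h.2.
Qed.

Lemma voltage_inj (A : graph) (u : vertex A) :
  {in edge_nbhd u &, injective (@voltage A)}.
Proof.
move=> [e b] [f c]; rewrite !inE /= => /andP[_ eb] /andP[_ fc] /ffunP/(_ e).
rewrite !ffunE eqxx /=; have [ef|_] := eqVneq e f.
  by subst f; case: is_loop eb fc; case: b; case: c.
by case: is_loop eb; case: b.
Qed.

Definition voltage_proj (A : graph)
  (v : vertex A * {ffun edge A -> 'Z_4}) : vertex A := v.1.

Definition voltage_nb (A : graph)
    (v : vertex A * {ffun edge A -> 'Z_4}) (h : edge A * bool) :=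
  (opposite v.1 h.1, v.2 + voltage h)%R.

Lemma voltage_proj_ex (A : graph) (u : vertex A) : exists v, voltage_proj v == u.
Proof. by exists (u, 0%R); apply/eqP. Qed.

Lemma voltage_proj_nb (A : graph)
    (v : vertex A * {ffun edge A -> 'Z_4}) (h : edge A * bool) :
  h \in edge_nbhd (voltage_proj v) ->
  voltage_proj (voltage_nb v h) = opposite (voltage_proj v) h.1.
Proof. by []. Qed.

Lemma voltage_nb_reverse (A : graph)
    (v : vertex A * {ffun edge A -> 'Z_4}) (h : edge A * bool) :
  h \in edge_nbhd (voltage_proj v) -> voltage_nb (voltage_nb v h) (reverse h) = v.
Proof.
case: v => u x Nh; rewrite /voltage_nb /= voltage_reverse; last first.
  by have := Nh; rewrite inE => /andP[].
by rewrite GRing.addrK oppositeK ?(nbhd_end Nh).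
Qed.

Lemma voltage_nb_inj (A : graph) (v : vertex A * {ffun edge A -> 'Z_4}) :
  {in edge_nbhd (voltage_proj v) &, injective (voltage_nb v)}.
Proof.
by move=> h k Nh Nk [_ /GRing.addrI]; apply: voltage_inj Nh Nk.
Qed.

Definition voltage_lift (A : graph) : lift A :=
  Lift (@voltage_proj_ex A) (@voltage_proj_nb A)
    (@voltage_nb_reverse A) (@voltage_nb_inj A).

Lemma voltage_lift_loopless (A : graph) : loopless (voltage_lift A).
Proof.
move=> v h _; apply/eqP => /(congr1 snd)/= /eqP.
rewrite -[X in _ == X]GRing.addr0 (inj_eq (@GRing.addrI _ _)).
by rewrite (negPf (voltage_neq0 h)).
Qed.

(** Fibres have size [4 ^ #|edge A|], which is even because [e] makes the exponent positive. *)
Lemma voltage_lift_even (A : graph) (e : edge A) :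
  ~~ odd #|lvertex (voltage_lift A)|.
Proof.
rewrite card_prod card_ffun card_ord oddM oddX orbF.
by rewrite [#|edge A|](cardD1 e) inE andbF.
Qed.

(** * Doubling a lift *)

Definition double_proj (A : graph) (L : lift A) (v : lvertex L * bool) :=
  proj v.1.

(* The layer changes exactly along the ends fixed by [nb], so that semi-edges of
   [L] become edges between the two layers. *)
Definition double_nb (A : graph) (L : lift A) (v : lvertex L * bool) h :=
  (nb v.1 h, v.2 (+) (nb v.1 h == v.1)).

Lemma double_proj_ex (A : graph) (L : lift A) (u : vertex A) :
  exists v : lvertex L * bool, double_proj v == u.
Proof. by have [v pv] := proj_ex L u; exists (v, false). Qed.

Lemma double_proj_nb (A : graph) (L : lift A) (v : lvertex L * bool) h :
  h \in edge_nbhd (double_proj v) ->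
  double_proj (double_nb v h) = opposite (double_proj v) h.1.
Proof. exact: proj_nb. Qed.

Lemma double_nb_reverse (A : graph) (L : lift A) (v : lvertex L * bool) h :
  h \in edge_nbhd (double_proj v) -> double_nb (double_nb v h) (reverse h) = v.
Proof.
case: v => v i Nh; rewrite /double_nb /= nb_reverse //.
by rewrite [v == _]eq_sym addbK.
Qed.

Lemma double_nb_inj (A : graph) (L : lift A) (v : lvertex L * bool) :
  {in edge_nbhd (double_proj v) &, injective (double_nb v)}.
Proof. by move=> h k Nh Nk [/(nb_inj Nh Nk)]. Qed.

Definition double (A : graph) (L : lift A) : lift A :=
  Lift (@double_proj_ex A L) (@double_proj_nb A L)
    (@double_nb_reverse A L) (@double_nb_inj A L).

Lemma double_loopless (A : graph) (L : lift A) : loopless (double L).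
Proof.
move=> [v i] h _; rewrite /= /double_nb xpair_eqE /=.
by case: eqP => //= _; rewrite addbT; case: i.
Qed.

(** * Inserting opened copies of a lift into the edges of [A] *)

(** An arbitrary end-vertex orients [e]; the copy of the lift inserted in [e] is cut at an edge
    whose tail lies over it. *)
Definition base (A : graph) (e : edge A) : vertex A := xchoose (ends_ex e).

Lemma base_end (A : graph) (e : edge A) : base e \in ends e.
Proof. exact: xchooseP (ends_ex e). Qed.

Lemma base_nbhd (A : graph) (e : edge A) : (e, false) \in edge_nbhd (base e).
Proof. exact/nbhd_false/base_end. Qed.

Definition is_semi (A : graph) (e : edge A) : bool :=
  if kind e is Semi then true else false.

(** Relative to [base], a loop or normal edge has an outgoing and an incoming end, a semi-edge only
    an outgoing one. The bit is tested because both ends of a loop lie at the base. *)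
Lemma nbhd_cases (A : graph) (u : vertex A) (h : edge A * bool) :
  h \in edge_nbhd u ->
  if (u == base h.1) && ~~ h.2 then u = base h.1 /\ h = (h.1, false)
  else [/\ ~~ is_semi h.1, u = opposite (base h.1) h.1 & h = reverse (h.1, false)].
Proof.
case: h => e b /= Nh; have /= ue := nbhd_end Nh.
have := Nh; rewrite inE /= ue /= => be; have eb := base_end e.
have [ub|ub] /= := eqVneq u (base e).
  case: b be {Nh} => /= [le|]; last by [].
  rewrite /reverse /= le -ub opposite_loop //.
  by move: le; rewrite /is_loop /is_semi; case: kind.
have ou := opposite_unique eb ue ub.
have := opposite_normal eb; rewrite -ou ub.
by case: b be {Nh}; rewrite /reverse /is_loop /is_semi; case: kind.
Qed.

Lemma semi_opposite (A : graph) (u : vertex A) (e : edge A) :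
  u \in ends e -> is_semi e -> opposite u e = u.
Proof.
move=> ue; rewrite /is_semi; have := opposite_normal ue.
by case: kind => // /negbFE/eqP.
Qed.

Lemma semi_reverse (A : graph) (e : edge A) b :
  is_semi e -> reverse (e, b) = (e, false).
Proof. by rewrite /is_semi /reverse /is_loop /=; case: kind. Qed.

Definition cut_tail (A : graph) (L : lift A) (e : edge A) : lvertex L :=
  xchoose (proj_ex L (base e)).

Definition cut_head (A : graph) (L : lift A) (e : edge A) : lvertex L :=
  nb (cut_tail L e) (e, false).

Definition insert_proj (A : graph) (L : lift A)
    (w : vertex A + edge A * lvertex L) : vertex A :=
  match w with inl u => u | inr (_, z) => proj z end.

(* One copy of [L] per edge [e] of [A], opened at the edge over [e] joining
   [cut_tail] to [cut_head]; the two loose ends are exchanged with those of [e]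
   in [A].  For a semi-edge [e] only [cut_head] is attached to [A], and
   [cut_tail] keeps a semi-edge. *)
Definition insert_nb (A : graph) (L : lift A)
    (w : vertex A + edge A * lvertex L) (h : edge A * bool) :
    vertex A + edge A * lvertex L :=
  match w with
  | inl u => inr (h.1, if (u == base h.1) && ~~ h.2 then cut_head L h.1
                       else cut_tail L h.1)
  | inr (e, z) =>
    if (z == cut_head L e) && (h == reverse (e, false)) then inl (base e)
    else if (z == cut_tail L e) && (h == (e, false)) then
      if is_semi e then inr (e, z) else inl (opposite (base e) e)
    else inr (e, nb z h)
  end.

Lemma proj_cut_tail (A : graph) (L : lift A) (e : edge A) :
  proj (cut_tail L e) = base e.
Proof. exact/eqP/(xchooseP (proj_ex L (base e))). Qed.

Lemma tail_nbhd (A : graph) (L : lift A) (e : edge A) :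
  (e, false) \in edge_nbhd (proj (cut_tail L e)).
Proof. by rewrite proj_cut_tail base_nbhd. Qed.

Lemma proj_cut_head (A : graph) (L : lift A) (e : edge A) :
  proj (cut_head L e) = opposite (base e) e.
Proof. by rewrite proj_nb ?tail_nbhd ?proj_cut_tail. Qed.

Lemma head_nbhd (A : graph) (L : lift A) (e : edge A) :
  reverse (e, false) \in edge_nbhd (proj (cut_head L e)).
Proof. by rewrite proj_cut_head (reverse_nbhd (base_nbhd e)). Qed.

Lemma nb_cut_head (A : graph) (L : lift A) (e : edge A) :
  nb (cut_head L e) (reverse (e, false)) = cut_tail L e.
Proof. by rewrite nb_reverse ?tail_nbhd. Qed.

Lemma head_neq_tail (A : graph) (L : lift A) (e : edge A) :
  loopless L -> cut_head L e != cut_tail L e.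
Proof. by move=> simL; apply: simL; apply: tail_nbhd. Qed.

Lemma insert_proj_ex (A : graph) (L : lift A) (u : vertex A) :
  exists w : vertex A + edge A * lvertex L, insert_proj w == u.
Proof. by exists (inl u); apply/eqP. Qed.

Lemma insert_proj_nb (A : graph) (L : lift A)
    (w : vertex A + edge A * lvertex L) h :
  h \in edge_nbhd (insert_proj w) ->
  insert_proj (insert_nb w h) = opposite (insert_proj w) h.1.
Proof.
case: w => [u|[e z]] /= Nh.
  have := nbhd_cases Nh; case: ifP => _; first by rewrite proj_cut_head => -[<-].
  by rewrite proj_cut_tail => -[_ -> _]; rewrite oppositeK ?base_end.
case: ifP => [/andP[/eqP-> /eqP->]|_].
  by rewrite proj_cut_head oppositeK ?base_end.
case: ifP => [/andP[/eqP-> /eqP->]|_]; last exact: proj_nb.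
case: ifP => [se|_]; rewrite /= proj_cut_tail //.
by rewrite semi_opposite ?base_end.
Qed.

Lemma insert_nb_reverse (A : graph) (L : lift A) (simL : loopless L)
    (w : vertex A + edge A * lvertex L) h :
  h \in edge_nbhd (insert_proj w) -> insert_nb (insert_nb w h) (reverse h) = w.
Proof.
have tail_head e : (cut_tail L e == cut_head L e) = false.
  by rewrite eq_sym; apply/negbTE/head_neq_tail.
case: w => [u|[e z]] /= Nh.
  have := nbhd_cases Nh; case: h {Nh} => f b /=; case: ifP => _ /=.
    by case=> -> ->; rewrite !eqxx.
  case=> /negbTE-> -> ->; rewrite tail_head eqxx /=.
  by rewrite (reverseK (base_nbhd _)) eqxx.
case: ifP => [/andP[/eqP-> /eqP->]|zh].
  by rewrite (reverseK (base_nbhd _)) /= !eqxx.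
case: ifP => [/andP[/eqP-> /eqP->]|zt].
  case: ifP => [se|se].
    by rewrite semi_reverse //= tail_head !eqxx se.
  (* From [opposite (base e) e] the reversed end must lead to the tail. Leading to the head would
     mean that [e] is neither a loop nor normal, yet it is not a semi-edge. *)
  have No := reverse_nbhd (base_nbhd e); have := nbhd_cases No.
  rewrite /=; case: ifP => // /andP[/eqP oe nr] _.
  have : ~~ is_loop e by move: nr; case: is_loop.
  by have := opposite_normal (base_end e); rewrite oe eqxx; move: se;
     rewrite /is_semi /is_loop; case: kind.
rewrite /= nb_reverse //.
have rev_eq k : k \in edge_nbhd (proj z) -> reverse k = reverse (e, false) ->
    k = (e, false).
  by move=> Nk rk; rewrite -(reverseK Nk) rk (reverseK (base_nbhd e)).
(* The way back along an uncut end is uncut: otherwise [h] at [z] would itself be a cut end, against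
   [zh] and [zt]. *)
case: ifP => [/andP[/eqP nh /eqP rh]|_].
  have hE := rev_eq _ Nh rh; move: zt.
  by rewrite -(nb_reverse Nh) nh rh nb_cut_head hE !eqxx.
case: ifP => // /andP[/eqP nt /eqP rh].
have hE : h = reverse (e, false) by rewrite -(reverseK Nh) rh.
by move: zh; rewrite -(nb_reverse Nh) nt rh hE !eqxx.
Qed.

(** From a vertex of [A], the copy reached names the edge, and head and tail separate the ends of a
    loop. In a copy, only the semi-edge kept at [cut_tail] returns to its own vertex, since [simL]
    forbids this to the other ends. *)
Lemma insert_nb_inj (A : graph) (L : lift A) (simL : loopless L)
    (w : vertex A + edge A * lvertex L) :
  {in edge_nbhd (insert_proj w) &, injective (insert_nb w)}.
Proof.
case: w => [u|[e z]] /= h k Nh Nk.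
  have := nbhd_cases Nk; have := nbhd_cases Nh.
  case: h k {Nh Nk} => e b [f c] /=.
  have ht : cut_head L e <> cut_tail L e by apply/eqP/head_neq_tail.
  case: ifP => _ [] // => [_ -> | _ _ ->].
    case: ifP => _ [] // => [_ -> [] -> //| _ _ -> [ef]]; subst f.
    by move/ht.
  case: ifP => _ [] // => [_ -> [ef] | _ _ -> [] -> //]; subst f.
  by move/esym/ht.
case: ifP => [/andP[/eqP zh /eqP hE]|_].
  case: ifP => [/andP[_ /eqP kE] _|_]; first by rewrite hE kE.
  case: ifP => [/andP[/eqP zt _]|_ //].
  by have := head_neq_tail e simL; rewrite -zh -zt eqxx.
case: ifP => [/andP[/eqP zt /eqP hE]|_].
  case: (is_semi e); case: ifP => [/andP[/eqP zh _]|_];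
    try (by have := head_neq_tail e simL; rewrite -zh -zt eqxx);
    case: ifP => [/andP[_ /eqP kE] _|_] //; try by rewrite hE kE.
  by case=> /esym/eqP; rewrite (negPf (simL _ _ Nk)).
case: ifP => // _; case: ifP => _; last by case=> /(nb_inj Nh Nk).
by case: (is_semi e) => // -[] /eqP; rewrite (negPf (simL _ _ Nh)).
Qed.

Definition insert (A : graph) (L : lift A) (simL : loopless L) : lift A :=
  Lift (@insert_proj_ex A L) (@insert_proj_nb A L)
    (insert_nb_reverse simL) (insert_nb_inj simL).

(** * Matchings of the inserted lift *)

Lemma involution_even (T : finType) (f : T -> T) (S : {set T}) :
  {in S, forall x, f x \in S} -> {in S, involutive f} ->
  {in S, forall x, f x != x} -> ~~ odd #|S|.
Proof.
have [n] := ubnP #|S|; elim: n S => // n IHn S leSn fS fK f_neq.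
have [->|[x xS]] := set_0Vmem S; first by rewrite cards0.
have fxS : f x \in S :\ x by rewrite in_setD1 f_neq ?fS.
have cardS : #|S| = #|(S :\ x) :\ f x|.+2.
  by rewrite (cardsD1 x) xS (cardsD1 (f x) (S :\ x)) fxS.
rewrite cardS /= negbK; apply: IHn => [|y|y|y].
- by rewrite cardS in leSn; apply: ltnW.
- rewrite !in_setD1 => /and3P[yfx yx yS]; rewrite fS // andbT.
  rewrite (can_in_eq fK) ?yx //=; apply: contra yfx => /eqP <-.
  by rewrite fK.
- by rewrite !in_setD1 => /and3P[_ _]; apply: fK.
- by rewrite !in_setD1 => /and3P[_ _]; apply: f_neq.
Qed.

(* The copy of [L] inserted in [e] has an even number of vertices and is joined
   to the rest by two edges only, so a perfect matching uses both or none. *)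
Lemma insert_matching (A : graph) (L : lift A) (simL : loopless L)
    (m : lvertex (double (insert simL)) -> edge A * bool) (e : edge A) :
  (forall v, m v \in edge_nbhd (proj v)) ->
  (forall v, m (nb v (m v)) = reverse (m v)) ->
  ~~ odd #|lvertex L| -> ~~ is_semi e ->
  (m (inl (base e), false) == (e, false)) =
  (m (inl (opposite (base e) e), false) == reverse (e, false)).
Proof.
move=> mN mR evenL nsemi.
pose pos z : lvertex (double (insert simL)) := (inr (e, z), false).
pose mate v := nb v (m v).
have mateK : involutive mate.
  by move=> v; rewrite /mate mR nb_reverse.
have mate_neq v : mate v != v by apply: double_loopless.
have ht := head_neq_tail e simL.
have nbh : nb (pos (cut_head L e)) (reverse (e, false)) = (inl (base e), false).
  by rewrite /= /double_nb /= !eqxx.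
have nbt : nb (pos (cut_tail L e)) (e, false) = (inl (opposite (base e) e), false).
  by rewrite /= /double_nb /= eq_sym (negPf ht) !eqxx /= (negPf nsemi).
have swap v w h : nb v h = w -> h \in edge_nbhd (proj v) ->
    (m w == reverse h) = (m v == h).
  move=> vw Nh; apply/eqP/eqP => [mw | mv]; last by rewrite -vw -{1}mv mR mv.
  by rewrite -(nb_reverse Nh) vw -mw mR mw (reverseK Nh).
(* [Y] consists of the vertices of the copy whose mates lie outside it. The others are paired off by
   [mate], so [Y] has even size. *)
pose Y := [set z | (z == cut_head L e) && (m (pos z) == reverse (e, false))
                || (z == cut_tail L e) && (m (pos z) == (e, false))].
have mate_pos z : z \notin Y -> exists2 y, mate (pos z) = pos y & y \notin Y.
  rewrite inE negb_or => /andP[/negPf zh /negPf zt].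
  (* Away from the cut the layer stays [false], because [L] is loopless. *)
  have mz : mate (pos z) = pos (nb z (m (pos z))).
    rewrite /mate /= /double_nb /= zh zt /pos; congr (_, _).
    apply/negP => /eqP[] /eqP; apply/negP; exact: (@simL _ _ (mN (pos z))).
  exists (nb z (m (pos z))) => //; apply/negP.
  have := mateK (pos z); rewrite mz; set y := nb z _; rewrite inE.
  move=> my /orP[] /andP[/eqP yE /eqP mE]; move: my;
    by rewrite /mate mE yE ?nbh ?nbt.
have : ~~ odd #|pos @: ~: Y|.
  apply: (involution_even (f := mate)) => [x /imsetP[z Yz ->]| v _ | v _] //.
  have [y -> Yy] : exists2 y, mate (pos z) = pos y & y \notin Y.
    by apply: mate_pos; rewrite inE in Yz.
  by rewrite imset_f // inE.
have pos_inj : injective pos by move=> y z [].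
rewrite card_imset // => evenY; move: evenL.
rewrite -(cardsC Y) oddD (negPf evenY).
(* Only the head and the tail can belong to [Y], so evenness means both or neither. *)
have -> : #|Y| = (m (pos (cut_head L e)) == reverse (e, false))
               + (m (pos (cut_tail L e)) == (e, false)).
  rewrite (cardsD1 (cut_head L e)) (cardsD1 (cut_tail L e)) !inE eqxx.
  rewrite [cut_tail L e == _]eq_sym (negPf ht) eqxx /= orbF addnA -[RHS]addn0; congr (_ + _).
  apply: eq_card0 => z; rewrite !inE.
  by case: (z == cut_head L e); case: (z == cut_tail L e).
rewrite -(swap _ _ _ nbt (tail_nbhd L e)) -(swap _ _ _ nbh (head_nbhd L e)).
rewrite (reverseK (base_nbhd e)) addbF oddD !oddb negb_add.
by move/eqP.
Qed.

(** * The matching induced on [A] *)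

Lemma stronger_F11_semicovers (A : graph) :
  stronger A (F 1 1) -> semicovers A (F 1 1).
Proof.
move=> strA; have simB := @voltage_lift_loopless A.
have [u0 _] := stronger_F11_vertex simB strA.
have deg3 := stronger_F11_deg simB strA.
have simD := @double_loopless A (insert simB).
have [m mN mR] := stronger_F11_matching simD strA.
pose core u : lvertex (double (insert simB)) := (inl u, false).
have parity e := insert_matching mN mR (voltage_lift_even e).
(* Each edge is tested at its base; [parity] transfers the test to the other end, and a semi-edge
   has no other end. *)
pose M := [set e | m (core (base e)) == (e, false)].
apply: (matching_semicovers_F11 u0 deg3 (M := M)) => u.
exists (m (core u)); first exact: (mN (core u)).
move=> [e b] Nk; rewrite inE [RHS]eq_sym; have /= := nbhd_cases Nk.
case: ifP => _; first by case=> -> ->.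
by case=> nsemi -> ->; rewrite parity.
Qed.

Theorem theorem6 (A : graph) : stronger A (F 1 1) <-> semicovers A (F 1 1).
Proof. by split; [apply: stronger_F11_semicovers | apply: semicovers_stronger]. Qed.
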